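(* Let $f:\mathbb{Z}\to(0,\infty)$ be a non-decreasing function such that $f(x)\cdot f(1-x)=1$ for all $x\in\mathbb{Z}$ and such that $\underline\theta<0<\bar\theta$ (the rate function of a bricklayer process), and let $\mathcal{H}$ be the associated hydrodynamic flux function. If $f$ is convex and is not the constant one function, then $\mathcal{H}$ is strictly convex.
   Context: Set $f(0)!:=1$, $f(x)!:=\prod_{y=1}^{x}f(y)$ for integers $x>0$, and $f(x)!:=1/\prod_{y=x+1}^{0}f(y)$ for integers $x<0$. Let $$\bar\theta:=\log\Bigl(\liminf_{x\to\infty}(f(x)!)^{1/x}\Bigr),\qquad \underline\theta:=\log\Bigl(\limsup_{x\to\infty}(f(-x)!)^{-1/x}\Bigr),$$ with values in $[-\infty,\infty]$. For $\underline\theta<\theta<\bar\theta$ define the probability measure $\mu^\theta$ on $\mathbb{Z}$ by $$\mu^\theta(x):=\frac{e^{\theta x}/f(x)!}{\sum_{y\in\mathbb{Z}} e^{\theta y}/f(y)!},$$ and let $\mathbf{E}^\theta$ denote expectation when $X$ and $Y$ are i.i.d. with distribution $\mu^\theta$. The function $\varrho(\theta):=\mathbf{E}^\theta X$ is strictly increasing on $(\underline\theta,\bar\theta)$; $\theta(\varrho)$ denotes its inverse function, defined on the range of $\varrho(\cdot)$. The hydrodynamic flux function is $\mathcal{H}(\varrho):=\mathbf{E}^{\theta(\varrho)}\bigl(f(X)+f(-Y)\bigr)$, for $\varrho$ in the range of $\varrho(\cdot)$. Convexity of $f$ on $\mathbb{Z}$ means that $x\mapsto f(x+1)-f(x)$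 is non-decreasing. *)

(* Defs.v *)
From HB Require Import structures.
From mathcomp Require Import all_boot all_order all_algebra.
From mathcomp Require Import all_classical all_reals all_analysis.

Set Implicit Arguments.
Unset Strict Implicit.
Unset Printing Implicit Defensive.

Import Order.TTheory GRing.Theory Num.Theory.
Import numFieldNormedType.Exports.

Local Open Scope classical_set_scope.
Local Open Scope ring_scope.

HB.instance Definition _ := isPointed.Build int 0.
HB.instance Definition _ := @isMeasurable.Build default_measure_display
  int discrete_measurable discrete_measurable0
  discrete_measurableC discrete_measurableU.

Section strict_convexity.
Local Open Scope convex_scope.

(* Strict counterpart of [convex_function]; the domain is required to be convex
   so that [g] is never evaluated outside of [D]. *)
Definition strictly_convex_function (R : numFieldType) (E : lmodType R)
    (E' := convex_lmodType E) (D : set E') (g : E' -> R^o) :=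
  convex_set D /\
  forall t : {i01 R}, 0 < t%:num < 1 ->
    {in D &, forall x y : E', x != y -> (g (x <| t |> y) < g x <| t |> g y)%R}.

End strict_convexity.

Section bricklayer.
Variables (R : realType) (f : int -> {posnum R}).
Implicit Types (theta rho : R) (x : int).

(* [Negz n] is [- n.+1], so that the second product ranges over the integers
   from [- n] to [0], i.e. over [x + 1 .. 0] for [x = - n.+1]. *)
Definition ffactorial x : R :=
  match x with
  | Posz n => \prod_(1 <= y < n.+1) (f y%:Z)%:num
  | Negz n => (\prod_(0 <= k < n.+1) (f (- k%:Z))%:num)^-1
  end.

Lemma ffactorial_gt0 x : 0 < ffactorial x.
Proof. by case: x => n /=; rewrite ?invr_gt0 prodr_gt0. Qed.

(* The term of index [0] is junk; it does not affect the limits. *)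
Definition theta_sup : \bar R :=
  lne (limn_einf (fun n : nat => (ffactorial n%:Z `^ n%:R^-1)%:E)).

Definition theta_inf : \bar R :=
  lne (limn_esup (fun n : nat => (ffactorial (- n%:Z) `^ (- n%:R^-1))%:E)).

Definition theta_range : set R :=
  [set theta | (theta_inf < theta%:E < theta_sup)%E].

Definition weight theta x : R := expR (theta * x%:~R) / ffactorial x.

Lemma weight_ge0 theta x : 0 <= weight theta x.
Proof. by rewrite divr_ge0 ?expR_ge0// ltW// ffactorial_gt0. Qed.

Definition gibbs theta (A : set int) : \bar R :=
  \esum_(x in A) (weight theta x)%:E.

Lemma gibbs0 theta : gibbs theta set0 = 0%E.
Proof. exact: esum_set0. Qed.

Lemma gibbs_ge0 theta A : (0 <= gibbs theta A)%E.
Proof. by apply: esum_ge0 => x _; rewrite lee_fin weight_ge0. Qed.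

Lemma gibbs_sigma_additive theta : semi_sigma_additive (gibbs theta).
Proof.
move=> F _ tF _.
have -> : gibbs theta (\bigcup_n F n) = (\sum_(n <oo) gibbs theta (F n))%E.
  rewrite nneseries_esumT; last by move=> n; exact: gibbs_ge0.
  rewrite /gibbs esum_bigcupT// => x.
  by rewrite lee_fin weight_ge0.
by apply: is_cvg_nneseries => n _ _; exact: gibbs_ge0.
Qed.

HB.instance Definition _ theta := isMeasure.Build _ _ _ (gibbs theta)
  (gibbs0 theta) (gibbs_ge0 theta) (@gibbs_sigma_additive theta).

(* The Dirac mass is the default value of [mnormalize] when the total mass is
   infinite, which does not happen for [theta] in [theta_range]. *)
Definition mu theta : probability int R := mnormalize (gibbs theta) \d_(0 : int).

Lemma gibbs_set1 theta x : gibbs theta [set x] = (weight theta x)%:E.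
Proof. by rewrite /gibbs esum_set1// lee_fin weight_ge0. Qed.

Lemma mu_set1 theta x : (gibbs theta setT < +oo)%E ->
  mu theta [set x] =
    (weight theta x / fine (\esum_(y in setT) (weight theta y)%:E))%:E.
Proof.
move=> foo; have gx_gt0 : (0 < gibbs theta [set x])%E.
  by rewrite gibbs_set1 lte_fin divr_gt0 ?expR_gt0 ?ffactorial_gt0.
have gT_gt0 : (0 < gibbs theta setT)%E.
  by apply: (lt_le_trans gx_gt0); apply: le_measure; rewrite ?inE.
rewrite /mu /= /mnormalize gt_eqF//= lt_eqF//=.
by rewrite gibbs_set1 EFinM.
Qed.

(* [fine] only converts types below: for [theta] in [theta_range] (resp. [rho]
   in [density_range]) the expectations are finite. *)
Definition density theta : R := fine 'E_(mu theta)[fun x => x%:~R].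

Definition density_range : set R := density @` theta_range.

Definition theta_of : R -> R := 'pinv_(fun=> 0) theta_range density.

Definition flux rho : R :=
  fine 'E_(mu (theta_of rho) \x mu (theta_of rho))%E
         [fun z : int * int => (f z.1)%:num + (f (- z.2))%:num].

End bricklayer.

(* Main.v *)
Require Import Defs.
From mathcomp Require Import all_boot all_order all_algebra.
From mathcomp Require Import all_classical all_reals all_analysis.
From mathcomp Require Import measurable_realfun ring lra zify.

Import Order.TTheory GRing.Theory Num.Theory.
Import numFieldNormedType.Exports.

Local Open Scope classical_set_scope.
Local Open Scope ring_scope.

(* Let [f] be convex. Being unbounded, it makes all the measures [mu theta],
   [theta] real, decay faster than any exponential. Given
   [theta1 < theta < theta2] such that [density theta] is
   [a * density theta1 + b * density theta2] with [a + b = 1], the function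
   [s] such that [a * mu theta1 + b * mu theta2 - mu theta] is [s * mu theta]
   is convex because it has the form
   [al * exp (u x) + be * exp (v x) - 1] with [u < 0 < v], so that
   [s <= 0] exactly on a bounded interval of integers. By the choice of [theta],
   [s * mu theta] annihilates affine functions. For a convex [phi], one can
   thus subtract from [phi] the line through its values at the ends of this
   interval: the difference has the sign of [s], so that the integral of
   [phi * s] is nonnegative, i.e., the expectation of [phi] is convex as a
   function of the density, and equality forces [phi] to be affine near
   infinity. This applies to the two terms of the flux, [f] and [f (- _)], and
   [f], positive and nondecreasing, is not affine near infinity. *)

(** * Integrals over the integers as sums over points *)

Section integral_int.
Context {R : realType}.
Implicit Types (nu : {measure set int -> \bar R}) (g : int -> \bar R).

(** The fibres of the injection [pickle] cut [int] into countably many pieces, each empty or a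
    single point; countable additivity concludes. *)
Lemma ge0_integral_int nu g : (forall x, 0 <= g x)%E ->
  (\int[nu]_x g x = \esum_(x in setT) (g x * nu [set x]))%E.
Proof.
move=> g0; pose F n : set int := [set x | pickle x = n].
have FT : \bigcup_n F n = setT by apply/seteqP; split=> // x _; exists (pickle x).
have tF : trivIset setT F by move=> m n _ _ [x [/= <- <-]].
rewrite -FT ge0_integral_bigcup//.
rewrite esum_bigcupT//; last by move=> x; rewrite mule_ge0.
rewrite nneseries_esumT; last by move=> n; exact: integral_ge0.
apply: eq_esum => n _.
have [[x Fx]|F0] := pselect (exists x, F n x); last first.
  suff -> : F n = set0 by rewrite integral_set0 esum_set0.
  by apply/seteqP; split=> // x Fx; apply: F0; exists x.
have -> : F n = [set x].
  apply/seteqP; split=> [y /= Fy|y /= -> //]; apply: (pcan_inj pickleK).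
  by rewrite /F/= in Fx; rewrite Fy Fx.
rewrite esum_set1 ?mule_ge0// -integral_cst//.
by apply: eq_integral => y /[!inE] ->.
Qed.

Lemma ge0_integral_int_density nu1 nu2 (c : int -> R) g :
  (forall x, 0 <= g x)%E -> (forall x, 0 <= c x) ->
  (forall x, nu1 [set x] = (c x)%:E * nu2 [set x])%E ->
  (\int[nu1]_x g x = \int[nu2]_x (g x * (c x)%:E))%E.
Proof.
move=> g0 c0 nuE; rewrite !ge0_integral_int//; last first.
  by move=> x; rewrite mule_ge0 ?lee_fin.
by apply: eq_esum => x _; rewrite nuE muleA.
Qed.

(** A change of measure on [int] is checked on points; this will serve for [mu f theta] against
    [gibbs f 0]. Multiplication by the nonnegative [c] commutes with positive and negative parts. *)
Lemma integral_int_density nu1 nu2 (c : int -> R) g : (forall x, 0 <= c x) ->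
  (forall x, nu1 [set x] = (c x)%:E * nu2 [set x])%E ->
  (\int[nu1]_x g x = \int[nu2]_x (g x * (c x)%:E))%E.
Proof.
move=> c0 nuE; rewrite [LHS]integralE [RHS]integralE.
by congr (_ - _)%E; rewrite (ge0_integral_int_density nu1 nu2 c)//;
  apply: eq_integral => x _; rewrite ?funeposE ?funenegE -?mulNe maxe_pMl ?lee_fin// mul0e.
Qed.

(** Comparison series for [tame_integrable]: each half-line is bounded by the geometric series of
    ratio [expR (- 1)]. *)
Lemma esum_exp_abs_lty : (\esum_(x in [set: int]) (expR (- `|x|%:~R))%:E < +oo :> \bar R)%E.
Proof.
have geo : (\esum_(n in [set: nat]) (expR (- n%:R))%:E < +oo :> \bar R)%E.
  rewrite -nneseries_esumT//.
  pose z : R := expR (- 1).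
  have -> : (fun n => \sum_(0 <= i < n) (expR (- i%:R))%:E)%E =
      EFin \o series (geometric 1 z) :> (nat -> \bar R).
    apply/funext => n /=; rewrite sumEFin /series/=; congr EFin.
    by apply: eq_bigr => i _; rewrite mul1r -expRM_natl mulrN1.
  rewrite EFin_lim ?ltry//; apply: cvgP; apply: cvg_geometric_series.
  by rewrite ger0_norm ?expR_ge0// expR_lt1 oppr_lt0.
rewrite (esumID (range Posz)); last by move=> x _; rewrite lee_fin expR_ge0.
rewrite !setTI lte_add_pinfty//.
  by rewrite esum_image// => x y _ _ [].
suff -> : ~` range Posz = range Negz.
  rewrite esum_image; last by move=> x y _ _ [].
  apply: le_lt_trans geo; apply: le_esum => n _.
  by rewrite lee_fin ler_expR lerN2 NegzE normrN ler_nat.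
apply/seteqP; split=> [[n|n] //= nn|_ [n _ <-] [m _]//].
  by case: nn; exists n.
by exists n.
Qed.
End integral_int.

(** * Convex functions on the integers *)

Section convex_on_int.
Context {R : realType}.
Implicit Types (g phi s : int -> R) (x y z m : int).

Definition convex_on_int g := forall x y, x <= y ->
  g (x + 1) - g x <= g (y + 1) - g y.

(** Induction on the distance from [x]: the increments to the right of [x] are at least the one at
    [x], those to its left at most. *)
Lemma convex_on_int_tangent {g} x y : convex_on_int g ->
  g x + (g (x + 1) - g x) * (y - x)%:~R <= g y.
Proof.
move=> gc; have [xy|yx] := leP x y.
- rewrite -[in g y](subrK x y) [y - x + x]addrC.
  have : 0 <= y - x by rewrite subr_ge0.
  case: (y - x) => // n _; elim: n => [|n IH].
    by rewrite -[Posz 0]/(0 : int) mulr0z mulr0 !addr0.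
  have := gc x (x + n%:Z); rewrite lerDl => /(_ isT).
  have -> : x + n%:Z + 1 = x + n.+1%:Z by rewrite intS; ring.
  by rewrite intS rmorphD/= mulrDr; lra.
- rewrite -[in g y](subKr x y) -[y - x]opprB rmorphN/=.
  have : 0 <= x - y by rewrite subr_ge0 ltW.
  case: (x - y) => // n _; elim: n => [|n IH].
    by rewrite -[Posz 0]/(0 : int) mulr0z !oppr0 mulr0 !addr0.
  have := gc (x - n.+1%:Z) x; rewrite lerBlDl lerDr => /(_ isT).
  have -> : x - n.+1%:Z + 1 = x - n%:Z by rewrite intS; ring.
  have -> : n.+1%:~R = 1 + n%:~R :> R by rewrite intS rmorphD.
  by lra.
Qed.

(** The tangent bounds at the middle point [y], weighted by [z - y] and [y - x], are added: the
    slope cancels. *)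
Lemma convex_on_int_chord g x y z : convex_on_int g -> x <= y -> y <= z ->
  (z - x)%:~R * g y <= (z - y)%:~R * g x + (y - x)%:~R * g z.
Proof.
move=> gc xy yz.
have gx := convex_on_int_tangent y x gc.
have gz := convex_on_int_tangent y z gc.
have xy0 : 0 <= (y - x)%:~R :> R by rewrite ler0z subr_ge0.
have yz0 : 0 <= (z - y)%:~R :> R by rewrite ler0z subr_ge0.
have := lerD (ler_wpM2l yz0 gx) (ler_wpM2l xy0 gz); apply: le_trans.
by rewrite !rmorphB/= le_eqVlt; apply/orP; left; apply/eqP; ring.
Qed.

Lemma convex_on_int_line g x y : convex_on_int g -> x <= y ->
  exists k, forall z,
    (x <= z <= y -> g z <= g x + k * (z - x)%:~R) /\
    ((z < x) || (y < z) -> g x + k * (z - x)%:~R <= g z).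
Proof.
move=> gc; rewrite le_eqVlt => /predU1P[<-|xy].
  (* When [x = y] there is no chord, and the tangent at [x] takes its place. *)
  exists (g (x + 1) - g x) => z; split; last by move=> _; exact: convex_on_int_tangent.
  by move=> /le_anti <-; rewrite subrr mulr0 addr0.
have xy0 : 0 < (y - x)%:~R :> R by rewrite ltr0z subr_gt0.
exists ((g y - g x) / (y - x)%:~R) => z.
have E : (y - x)%:~R * (g x + (g y - g x) / (y - x)%:~R * (z - x)%:~R) =
    (y - z)%:~R * g x + (z - x)%:~R * g y :> R.
  rewrite mulrDr !mulrA mulrC [_ * (_ - _)]mulrC mulfK ?gt_eqF//.
  by rewrite !rmorphB/=; ring.
split=> [/andP[xz zy]|/orP[zx|yz]]; rewrite -(ler_pM2l xy0) E.
- exact: convex_on_int_chord.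
- have := convex_on_int_chord g z x y gc (ltW zx) (ltW xy).
  by rewrite !rmorphB/=; lra.
- have := convex_on_int_chord g x y z gc (ltW xy) (ltW yz).
  by rewrite !rmorphB/=; lra.
Qed.

(** The set where [s <= 0] is nonempty and bounded; [x] and [y] are its extreme points, and the
    chord inequality keeps [s <= 0] between them. *)
Lemma convex_on_int_sign s (B : nat) : convex_on_int s ->
  (forall x, (B < `|x|)%N -> 0 < s x) -> (exists x, s x <= 0) ->
  exists x y, x <= y /\ forall z,
    (x <= z <= y -> s z <= 0) /\ ((z < x) || (y < z) -> 0 < s z).
Proof.
move=> sc sB [x0 sx0].
(* With [e] equal to [1] or [-1], [n] is the last step in this direction from [x0] at which
   [s <= 0]. *)
have end_ (e : int) : `|e|%N = 1%N -> exists2 n : nat, s (x0 + e * n%:Z) <= 0 &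
    forall k : nat, (n < k)%N -> 0 < s (x0 + e * k%:Z).
  move=> e1; pose P (n : nat) := s (x0 + e * n%:Z) <= 0.
  have P0 : exists n, P n by exists 0%N; rewrite /P mulr0 addr0.
  have Pmax n : P n -> (n <= B + `|x0|%N)%N.
    rewrite /P leNgt; apply: contraNleq => Bn; apply: sB.
    have : `|(e * n%:Z)%R|%N = n by rewrite abszM e1 mul1n.
    lia.
  case: (ex_maxnP P0 Pmax) => n Pn nmax; exists n => // k nk.
  by rewrite ltNge; apply/negP => /nmax; rewrite leqNgt nk.
have [n1 s1 s1_gt0] := end_ (-1) erefl.
have [n2 s2 s2_gt0] := end_ 1 erefl.
exists (x0 - n1%:Z), (x0 + n2%:Z).
rewrite mulN1r in s1; rewrite mul1r in s2.
have xy : x0 - n1%:Z <= x0 + n2%:Z by lia.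
split=> // z; split=> [/andP[xz zy]|/orP[zx|yz]].
- move: xy; rewrite le_eqVlt => /predU1P[xy|xy].
    by rewrite (_ : z = x0 + n2%:Z)//; lia.
  have := convex_on_int_chord s _ _ _ sc xz zy.
  rewrite -(@pmulr_rle0 _ (x0 + n2%:Z - (x0 - n1%:Z))%:~R) ?ltr0z ?subr_gt0//.
  move/le_trans; apply; rewrite -[leRHS]addr0 lerD// mulr_ge0_le0// ler0z; lia.
- rewrite (_ : z = x0 + -1 * `|x0 - z|%N%:Z); last lia.
  by apply: s1_gt0; lia.
- rewrite (_ : z = x0 + 1 * `|z - x0|%N%:Z); last lia.
  by apply: s2_gt0; lia.
Qed.

(* A convex function minus the line through its values at the ends of an
   interval has the sign of a convex function vanishing at these ends. *)
Lemma convex_on_int_crossing phi s (B : nat) :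
  convex_on_int phi -> convex_on_int s ->
  (forall x, (B < `|x|)%N -> 0 < s x) -> (exists x, s x <= 0) ->
  exists c k, forall x, 0 <= (phi x - (c + k * x%:~R)) * s x.
Proof.
move=> phic sc sB s0; have [x [y [xy sP]]] := convex_on_int_sign s B sc sB s0.
have [k phiP] := convex_on_int_line phi x y phic xy.
exists (phi x - k * x%:~R), k => z.
have [s_le0 s_gt0] := sP z; have [phi_le phi_ge] := phiP z.
have -> : phi x - k * x%:~R + k * z%:~R = phi x + k * (z - x)%:~R.
  by rewrite rmorphB/=; ring.
have [xzy|] := boolP (x <= z <= y).
  by rewrite mulr_le0 ?subr_le0 ?phi_le ?s_le0.
rewrite negb_and -!ltNge => xzy.
by rewrite mulr_ge0 ?subr_ge0 ?phi_ge// ltW// s_gt0.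
Qed.

(** Up to the factor [a], the increment at [z] is [expR (b * z) * (expR b - 1)]; it is nondecreasing
    in [z] for either sign of [b], since [expR b - 1] has the sign of [b]. *)
Lemma convex_on_int_expR (a b : R) : 0 <= a ->
  convex_on_int (fun x => a * expR (b * x%:~R)).
Proof.
move=> a0 x y xy; rewrite -!mulrBr ler_wpM2l//.
have E z : expR (b * (z + 1)%:~R) - expR (b * z%:~R) =
    expR (b * z%:~R) * (expR b - 1) :> R.
  by rewrite rmorphD/= mulrDr expRD mulr1 mulrBr mulr1.
have xy' : x%:~R <= y%:~R :> R by rewrite ler_int.
rewrite (E x) (E y); have [b0|b0] := leP 0 b.
  have eb : 0 <= expR b - 1 by rewrite subr_ge0 -[leLHS]expR0 ler_expR.
  by apply: ler_wpM2r => //; rewrite ler_expR; apply: ler_wpM2l.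
have eb : expR b - 1 <= 0 by rewrite subr_le0 -[leRHS]expR0 ler_expR ltW.
by apply: ler_wnM2r => //; rewrite ler_expR; apply: ler_wnM2l => //; exact: ltW.
Qed.

Lemma convex_on_int_expR2 (a b u v : R) : 0 <= a -> 0 <= b ->
  convex_on_int (fun x => a * expR (u * x%:~R) + b * expR (v * x%:~R) - 1).
Proof.
move=> a0 b0 x y xy.
rewrite -!addrA ![_ + (- 1)]addrC.
have := lerD (convex_on_int_expR a u a0 x y xy) (convex_on_int_expR b v b0 x y xy).
move: (a * _) (a * _) (a * _) (a * _) (b * _) (b * _) (b * _) (b * _) => *; lra.
Qed.

(** Far from the origin a single exponential term already exceeds [1]: the first on the left, the
    second on the right. *)
Lemma expR2_gt1 (a b u v : R) : 0 < a -> 0 < b -> u < 0 -> 0 < v ->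
  exists B : nat, forall x, (B < `|x|)%N ->
    0 < a * expR (u * x%:~R) + b * expR (v * x%:~R) - 1.
Proof.
move=> a0 b0 u0 v0.
have au : 0 < a * - u by rewrite mulr_gt0// oppr_gt0.
have bv : 0 < b * v by rewrite mulr_gt0.
(* Since [expR y >= 1 + y], the term [c * expR (w * t)] exceeds [1] once [t > 1 / (c * w)]; the sum
   of the two thresholds serves both sides. *)
exists (Num.truncn ((a * - u)^-1 + (b * v)^-1)).+1 => x Bx.
have xq : (a * - u)^-1 + (b * v)^-1 < `|x|%N%:R.
  by rewrite (lt_trans (truncnS_gt _))// ltr_nat.
have aP : 0 < a * expR (u * x%:~R) by rewrite mulr_gt0 ?expR_gt0.
have bP : 0 < b * expR (v * x%:~R) by rewrite mulr_gt0 ?expR_gt0.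
have step (c w t : R) : 0 < c -> 0 < c * w -> (c * w)^-1 < t -> 1 < c * expR (w * t).
  move=> c0 cw ct; apply: (@lt_le_trans _ _ (c * (1 + w * t))).
    by rewrite mulrDr mulr1 mulrA ltr_pwDl// -ler_pdivrMl// mulr1 ltW.
  by rewrite ler_pM2l// expR_ge1Dx.
have [x0|x0] := leP 0 x.
- suff : 1 < b * expR (v * x%:~R) by lra.
  apply: step => //; have -> : x%:~R = `|x|%N%:R :> R by case: x x0 {Bx xq aP bP}.
  by apply: lt_trans xq; rewrite ltr_pwDl// invr_gt0.
- suff : 1 < a * expR (u * x%:~R) by lra.
  have -> : u * x%:~R = - u * `|x|%N%:R.
    by case: x x0 {Bx xq aP bP} => // n _; rewrite NegzE rmorphN/= mulrN mulNr.
  apply: step => //.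
  by apply: lt_trans xq; rewrite ltr_pwDr// invr_gt0.
Qed.
End convex_on_int.

Lemma continuous_scaled_expR {R : realType} (c a : R) :
  continuous (fun t : R => c * expR (t * a)).
Proof.
move=> t; apply: cvgMr; apply: continuous_comp; last exact: continuous_expR.
exact: mulrr_continuous.
Qed.

Section bricklayer_weights.
Context {R : realType} (f : int -> {posnum R}).
Context (f_nondecreasing : forall x y : int, x <= y -> (f x)%:num <= (f y)%:num).
Context (f_symm : forall x : int, (f x)%:num * (f (1 - x))%:num = 1).
Context (f_convex : convex_on_int (fun x => (f x)%:num)).
Context (f_neq1 : ~ (forall x : int, (f x)%:num = 1)).
Implicit Types (theta : R) (g h : int -> R) (x y : int).

(** * Growth of the factorial of [f], and the functions it dominates *)

Local Notation ff := (ffactorial f).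

Lemma ffactorial_rec x : ff (x + 1) = (f (x + 1))%:num * ff x.
Proof.
case: x => [n|[|n]].
- rewrite (_ : Posz n + 1 = n.+1%:Z)/=; last by rewrite intS addrC.
  by rewrite big_nat_recr//= mulrC.
- rewrite (_ : Negz 0 + 1 = 0)//= big_geq// big_nat1 oppr0 divff//.
- rewrite (_ : Negz n.+1 + 1 = Negz n); last by rewrite !NegzE !intS; ring.
  rewrite [in RHS]/= big_nat_recr//= -NegzE invfM mulrCA divff ?mulr1//.
Qed.

(** Passing from [n] to [n + 1] multiplies by [f (n + 1)] on the right and by [1 / f (- n)] on the
    left, which agree by [f_symm]. Growth estimates thus carry over to the negative integers. *)
Lemma ffactorialN x : ff (- x) = ff x.
Proof.
suff H (n : nat) : ff (- n%:Z) = ff n%:Z by case: x => n; rewrite ?NegzE ?opprK ?H.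
elim: n => [|n IH]; first by rewrite oppr0.
have := ffactorial_rec n%:Z; have := ffactorial_rec (- n.+1%:Z).
rewrite (_ : - n.+1%:Z + 1 = - n%:Z); last by rewrite intS; ring.
rewrite (_ : n%:Z + 1 = n.+1%:Z); last by rewrite intS; ring.
rewrite IH => -> ->; rewrite mulrA.
have := f_symm n.+1%:Z; rewrite (_ : 1 - n.+1%:Z = - n%:Z); last by rewrite intS; ring.
by move=> ->; rewrite mul1r.
Qed.

Lemma rate_cst x0 : (forall x, (f x)%:num = (f x0)%:num) -> False.
Proof.
move=> fc; apply: f_neq1 => x; rewrite fc; have := f_symm x.
rewrite (fc x) (fc (1 - x)) -expr2 => /eqP; rewrite sqrf_eq1 => /predU1P[//|/eqP fN1].
by have := [gt0 of (f x0)%:num]; rewrite fN1 ltr0N1.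
Qed.

(** The tangent at a point [x0] with positive increment [d] gives at least linear growth. *)
Lemma rate_unbounded (K : R) : exists N : nat, forall n : nat, (N <= n)%N ->
  K <= (f n%:Z)%:num.
Proof.
have [x0 x0P] : exists x, 0 < (f (x + 1))%:num - (f x)%:num.
  (* Without a positive increment, the nondecreasing [f] would be constant. *)
  apply: contrapT => nx; apply: (rate_cst 0) => x.
  have fS y : (f (y + 1))%:num = (f y)%:num.
    apply/le_anti/andP; split; last by apply: f_nondecreasing; rewrite lerDl.
    by rewrite -subr_le0 leNgt; apply/negP => ?; apply: nx; exists y.
  have fN (n : nat) y : (f (y + n%:Z))%:num = (f y)%:num.
    elim: n => [|n IH]; first by rewrite addr0.
    by rewrite intS [1 + _]addrC addrA fS.
  case: x => n; first by rewrite -(fN n 0) add0r.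
  by rewrite -(fN n.+1 (Negz n)) NegzE addNr.
set d := _ - _ in x0P.
have [N] : exists N : nat, (K - (f x0)%:num) / d < N%:R.
  by exists (Num.truncn `|(K - (f x0)%:num) / d|).+1;
    rewrite (le_lt_trans (ler_norm _))// truncnS_gt.
rewrite ltr_pdivrMr// => KN; exists (N + `|x0|)%N => n Nn.
apply: le_trans (convex_on_int_tangent x0 n%:Z f_convex).
rewrite -lerBlDl (le_trans (ltW KN))// mulrC ler_pM2l// pmulrn ler_int; lia.
Qed.

(** Consecutive factorials have ratio [f (n + 1)], eventually at least [expR K]; the constant [C]
    absorbs the finitely many first indices. *)
Lemma ffactorial_growth (K : R) :
  exists C, forall x, expR (K * `|x|%:~R) <= C * ff x.
Proof.
have [N fN] := rate_unbounded (expR K).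
suff [C CP] : exists C, forall n : nat, expR (K * n%:R) <= C * ff n%:Z.
  exists C => -[n|n]; first exact: CP.
  by rewrite NegzE ffactorialN normrN; exact: CP.
have [C C0 CP] : exists2 C, 0 <= C &
    forall n : nat, (n <= N)%N -> expR (K * n%:R) <= C * ff n%:Z.
  elim: N {fN} => [|N [C C0 CP]].
    exists 1 => // n; rewrite leqn0 => /eqP ->.
    by rewrite mulr0 expR0 /= big_geq// mulr1.
  have ffN := ffactorial_gt0 f N.+1%:Z.
  have D0 : 0 <= expR (K * N.+1%:R) / ff N.+1%:Z by rewrite divr_ge0 ?expR_ge0// ltW.
  exists (C + expR (K * N.+1%:R) / ff N.+1%:Z); first by rewrite addr_ge0.
  move=> n; rewrite leq_eqVlt => /predU1P[->|nN].
    by rewrite mulrDl divfK ?gt_eqF// lerDr mulr_ge0// ltW.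
  rewrite mulrDl (le_trans (CP n nN))// lerDl mulr_ge0// ltW//.
  exact: ffactorial_gt0.
exists C; elim=> [|n IH]; first exact: CP.
have [nN|Nn] := leqP n.+1 N; first exact: CP.
have := ffactorial_rec n%:Z.
rewrite (_ : n%:Z + 1 = n.+1%:Z); last by rewrite intS; ring.
move=> ->; rewrite -[n.+1%:R]natr1 mulrDr mulr1 expRD mulrCA mulrC ler_pM ?expR_ge0//.
by apply: fN; exact: ltnW.
Qed.

(** Against the weights [1 / ff x], such a [g] decays faster than any exponential. As [K] is
    arbitrary, the class is stable under multiplication by exponentials, and its members are
    integrable for all the measures at hand. *)
Definition tame g := forall K : R, exists C, forall x,
  `|g x| * expR (K * `|x|%:~R) <= C * ff x.

Lemma tame1 : tame (fun=> 1).
Proof.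
move=> K; have [C CP] := ffactorial_growth K.
by exists C => x; rewrite normr1 mul1r.
Qed.

Lemma tame_ext g h : g =1 h -> tame g -> tame h.
Proof. by move=> /funext ->. Qed.

Lemma tameD g h : tame g -> tame h -> tame (fun x => g x + h x).
Proof.
move=> tg th K; have [C CP] := tg K; have [D DP] := th K.
exists (C + D) => x; rewrite mulrDl (le_trans _ (lerD (CP x) (DP x)))//.
by rewrite -mulrDl ler_wpM2r ?expR_ge0// ler_normD.
Qed.

Lemma tameMexp (c : R) g h : (forall x, `|h x| <= expR (c * `|x|%:~R)) ->
  tame g -> tame (fun x => h x * g x).
Proof.
move=> hc tg K; have [C CP] := tg (c + K).
exists C => x; apply: le_trans (CP x).
rewrite normrM [_ * `|g x|]mulrC -mulrA mulrDl expRD ler_wpM2l//.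
by rewrite ler_wpM2r ?expR_ge0.
Qed.

Lemma tame_expR theta g : tame g -> tame (fun x => expR (theta * x%:~R) * g x).
Proof.
apply: (@tameMexp `|theta|) => x.
by rewrite ger0_norm ?expR_ge0// ler_expR intr_norm -normrM ler_norm.
Qed.

Lemma tame_id g : tame g -> tame (fun x => x%:~R * g x).
Proof.
apply: (@tameMexp 1) => x; rewrite mul1r -intr_norm.
by rewrite (le_trans _ (expR_ge1Dx _))// lerDr.
Qed.

Lemma tameZ (c : R) g : tame g -> tame (fun x => c * g x).
Proof.
move=> tg K; have [C CP] := tg K; exists (`|c| * C) => x.
by rewrite normrM -!mulrA ler_wpM2l.
Qed.

Lemma tame_norm g : tame g -> tame (fun x => `|g x|).
Proof. by move=> tg K; have [C CP] := tg K; exists C => x; rewrite normr_id. Qed.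

(** Since [f x / ff x = 1 / ff (x - 1)], this is the growth of [ff] at [x - 1]; the factor
    [expR |K|] pays for the shift. *)
Lemma tame_rate : tame (fun x => (f x)%:num).
Proof.
move=> K; have [C CP] := ffactorial_growth `|K|.
exists (C * expR `|K|) => x; have := CP (x - 1).
have := ffactorial_rec (x - 1); rewrite subrK => -> H.
rewrite ger0_norm// [leRHS]mulrCA ler_wpM2l//.
rewrite -mulrA [_ * ff _]mulrC mulrA -ler_pdivrMr ?expR_gt0// -expRN -expRD.
apply: le_trans H; rewrite ler_expR lerBlDr -{2}[`|K|]mulr1 -mulrDr.
have x1 : `|x|%:~R <= `|x - 1|%:~R + 1 :> R.
  by rewrite -[1]/(1%:~R) -rmorphD ler_int; lia.
apply: (@le_trans _ _ (`|K| * `|x|%:~R)); last by rewrite ler_wpM2l.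
by rewrite ler_wpM2r ?ler_norm// ler0z.
Qed.

Lemma tame_rateN : tame (fun x => (f (- x))%:num).
Proof.
move=> K; have [C CP] := tame_rate K; exists C => x.
by have := CP (- x); rewrite ffactorialN normrN.
Qed.

Lemma tame_integrable g : tame g -> (gibbs f 0).-integrable setT (EFin \o g).
Proof.
move=> tg; have [C CP] := tg 1.
(* The bound at [0] gives [C >= 0]; adding [1] permits division. *)
have C0 : 0 < C + 1.
  rewrite ltr_wpDl//; have := CP 0.
  rewrite mul1r normr0 expR0 mulr1 /= big_geq// mulr1.
  exact: le_trans.
pose h x := (C + 1)^-1 * g x.
suff ih : (gibbs f 0).-integrable setT (EFin \o h).
  have := integrableZl measurableT (C + 1) ih; apply: eq_integrable => // x _ /=.
  by rewrite -EFinM mulrA mulfV ?gt_eqF// mul1r.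
apply/integrableP; split=> //.
rewrite ge0_integral_int//.
apply: (@le_lt_trans _ _ (\esum_(x in [set: int]) (expR (- `|x|%:~R))%:E)%E).
  apply: le_esum => x _; rewrite /= gibbs_set1 -!EFinM lee_fin /weight mul0r expR0 mul1r.
  rewrite ler_pdivrMr ?ffactorial_gt0// mulrC expRN ler_pdivlMr ?expR_gt0//.
  rewrite /h normrM gtr0_norm ?invr_gt0// -mulrA ler_pdivrMl//.
  have := CP x; rewrite mul1r => /le_trans; apply.
  by rewrite ler_wpM2r ?lerDl// ltW// ffactorial_gt0.
exact: esum_exp_abs_lty.
Qed.

(** * The measures [mu f theta] as densities with respect to [gibbs f 0] *)

Local Notation M := (gibbs f 0).

(** At parameter [0] the weights are [1 / ff x], so this is the normalizing sum of
    [expR (theta * x) / ff x]. *)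
Definition partition_function theta : R := \int[M]_x expR (theta * x%:~R).

Definition gibbs_density theta x : R := expR (theta * x%:~R) / partition_function theta.

Local Notation p := gibbs_density.

(** The expectation of [g] under [mu f theta], for tame [g] (see [integral_mu]), written against the
    fixed [M] so that several parameters combine under one integral. *)
Definition mean theta g : R := \int[M]_x (g x * p theta x).

Lemma tame_exp theta : tame (fun x => expR (theta * x%:~R)).
Proof.
by apply: tame_ext (tame_expR theta _ tame1) => x; rewrite mulr1.
Qed.

(** In particular the total mass is finite, so that [mu] does not take its Dirac default. *)
Lemma gibbs_setT theta : gibbs f theta setT = (partition_function theta)%:E.
Proof.
rewrite /partition_function /Rintegral fineK; last first.
  exact: (integrable_fin_num _ (tame_integrable _ (tame_exp theta))).
rewrite ge0_integral_int; last by move=> x; rewrite lee_fin expR_ge0.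
apply: eq_esum => x _.
by rewrite /= gibbs_set1 -EFinM /weight mul0r expR0 mul1r.
Qed.

Lemma partition_function_gt0 theta : 0 < partition_function theta.
Proof.
rewrite -lte_fin -gibbs_setT (@lt_le_trans _ _ (gibbs f theta [set 0]))//; last first.
  by apply: le_measure; rewrite ?inE.
by rewrite gibbs_set1 lte_fin divr_gt0 ?expR_gt0 ?ffactorial_gt0.
Qed.

Lemma gibbs_density_gt0 theta x : 0 < p theta x.
Proof. by rewrite divr_gt0 ?expR_gt0 ?partition_function_gt0. Qed.

Lemma mu_density theta x : mu f theta [set x] = ((p theta x)%:E * M [set x])%E.
Proof.
rewrite mu_set1; last by rewrite gibbs_setT ltry.
rewrite -[esum _ _]/(gibbs f theta setT) gibbs_setT/= gibbs_set1 -EFinM; congr EFin.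
by rewrite /weight mul0r expR0 mul1r mulrAC.
Qed.

Lemma tame_density theta g : tame g -> tame (fun x => g x * p theta x).
Proof.
move=> tg; apply: tame_ext (tameZ (partition_function theta)^-1 _ (tame_expR theta _ tg)) => x.
by rewrite mulrA mulrC [_^-1 * _]mulrC.
Qed.

Lemma integral_mu theta g : tame g ->
  (\int[mu f theta]_x (g x)%:E)%E = (mean theta g)%:E.
Proof.
move=> tg.
have p0 x : 0 <= p theta x by rewrite ltW// gibbs_density_gt0.
rewrite (integral_int_density _ _ _ (fun x => (g x)%:E) p0 (mu_density theta)).
by rewrite /mean /Rintegral fineK//; exact/integrable_fin_num/tame_integrable/tame_density.
Qed.

Lemma mean1 theta : mean theta (fun=> 1) = 1.
Proof.
apply: EFin_inj; rewrite -integral_mu//; last exact: tame1.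
by rewrite integral_cst// mul1e; exact: probability_setT.
Qed.

Lemma tame_intr : tame (fun x => x%:~R).
Proof. by apply: tame_ext (tame_id _ tame1) => x; rewrite mulr1. Qed.

Lemma density_mean theta : density f theta = mean theta (fun x => x%:~R).
Proof.
by rewrite /density expectation.unlock integral_mu//; exact: tame_intr.
Qed.

(** Tonelli: each term depends on one coordinate only, and the other coordinate has total mass
    [1]. *)
Lemma flux_mean rho : flux f rho =
  mean (theta_of f rho) (fun x => (f x)%:num) +
  mean (theta_of f rho) (fun x => (f (- x))%:num).
Proof.
rewrite /flux; set th := theta_of f rho; rewrite expectation.unlock.
have mf1 : measurable_fun [set: int * int] (fun z : int * int => (f z.1)%:num).
  exact: (@measurableT_comp _ _ _ _ _ _ (fun x => (f x)%:num) _ fst).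
have mf2 : measurable_fun [set: int * int] (fun z : int * int => (f (- z.2))%:num).
  exact: (@measurableT_comp _ _ _ _ _ _ (fun x => (f (- x))%:num) _ snd).
rewrite fubini_tonelli1//; last exact/measurable_EFinP/measurable_funD.
transitivity (fine (\int[mu f th]_x
  ((f x)%:num%:E + (mean th (fun y => (f (- y))%:num))%:E)))%E.
  congr fine; apply: eq_integral => x _.
  rewrite -(integral_mu _ _ tame_rateN) -[X in (X + _)%E]mule1.
  rewrite -[1%E in RHS](@probability_setT _ _ _ (mu f th)).
  by rewrite -integral_cst// -ge0_integralD// => y _; rewrite lee_fin.
rewrite ge0_integralD//; last first.
  by move=> x _; rewrite lee_fin; apply: Rintegral_ge0 => y _; rewrite mulr_ge0// ltW// gibbs_density_gt0.
rewrite (integral_mu _ _ tame_rate) integral_cst//.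
by rewrite [X in (_ * X)%E](_ : _ = 1%E) ?mule1//; exact: probability_setT.
Qed.

(** Every integer has positive mass under [M]. *)
Lemma Rintegral_gibbs_eq0 g : tame g -> (forall x, 0 <= g x) ->
  \int[M]_x g x = 0 -> forall x, g x = 0.
Proof.
move=> tg g0 ig0 x.
have : (\int[M]_y (g y)%:E = 0)%E.
  rewrite -[LHS]fineK; last exact: (integrable_fin_num _ (tame_integrable _ tg)).
  by congr EFin.
rewrite ge0_integral_int; last by move=> y; rewrite lee_fin.
move=> e0; have : ((g x)%:E * M [set x] <= 0)%E.
  rewrite -e0; apply: esum_ge; exists [set x]; first by split.
  by rewrite fsbig_set1.
rewrite /= gibbs_set1 -EFinM lee_fin pmulr_lle0; last first.
  by rewrite divr_gt0 ?expR_gt0 ?ffactorial_gt0.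
by move=> gx; apply/eqP; rewrite eq_le gx g0.
Qed.

Lemma Rintegral_gibbsD g h : tame g -> tame h ->
  \int[M]_x (g x + h x) = \int[M]_x g x + \int[M]_x h x.
Proof. by move=> tg th; rewrite RintegralD//; exact: tame_integrable. Qed.

Lemma Rintegral_gibbsZ c g : tame g ->
  \int[M]_x (c * g x) = c * \int[M]_x g x.
Proof. by move=> tg; rewrite RintegralZl//; exact: tame_integrable. Qed.

(** Dominated convergence: for [theta] within [1] of [a], [expR (theta * x)] is at most the sum of
    its values at [a - 1] and [a + 1]. *)
Lemma continuous_Rintegral_expR g : tame g ->
  continuous (fun theta => \int[M]_x (g x * expR (theta * x%:~R))).
Proof.
move=> tg a.
have te theta : tame (fun x => g x * expR (theta * x%:~R)).
  by apply: tame_ext (tame_expR theta _ tg) => x; rewrite mulrC.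
apply: (@continuity_under_integral _ _ _ M (fun theta x => g x * expR (theta * x%:~R))
  setT measurableT (a - 1) (a + 1) _ _
  (fun x => `|g x| * expR ((a - 1) * x%:~R) + `|g x| * expR ((a + 1) * x%:~R))).
- by move=> theta _; exact: tame_integrable.
- by apply: aeW => x _ theta _; exact: continuous_scaled_expR.
- apply: tame_integrable; apply: tameD.
    by apply: tame_ext (tame_norm _ (te (a - 1))) => x; rewrite normrM [X in _ * X]gtr0_norm ?expR_gt0.
  by apply: tame_ext (tame_norm _ (te (a + 1))) => x; rewrite normrM [X in _ * X]gtr0_norm ?expR_gt0.
- move=> theta; rewrite /= in_itv/= => /andP[at_ ta]; apply: aeW => x _.
  rewrite normrM [X in _ * X]gtr0_norm ?expR_gt0// -mulrDr ler_wpM2l//.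
  have [x0|x0] := leP 0 (x%:~R : R).
    by rewrite ler_wpDl ?expR_ge0// ler_expR ler_wpM2r// ltW.
  by rewrite ler_wpDr ?expR_ge0// ler_expR ler_wnM2r// ltW.
- by rewrite inE/= in_itv/= ltrBlDr ltrDl ltr01.
Qed.

Lemma continuous_density : continuous (density f).
Proof.
have -> : density f = fun theta =>
    (\int[M]_x (x%:~R * expR (theta * x%:~R))) / \int[M]_x (1 * expR (theta * x%:~R)).
  apply/funext => theta; rewrite density_mean /mean.
  transitivity (\int[M]_x ((partition_function theta)^-1 * (x%:~R * expR (theta * x%:~R)))).
    by apply: eq_Rintegral => x _; rewrite /gibbs_density [RHS]mulrC mulrA.
  rewrite (Rintegral_gibbsZ (partition_function theta)^-1 _ (tame_id _ (tame_exp theta))).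
  by rewrite mulrC; congr (_ / _); apply: eq_Rintegral => x _; rewrite mul1r.
move=> theta; apply: cvgM; first exact: (continuous_Rintegral_expR _ tame_intr).
apply: cvgV; last exact: (continuous_Rintegral_expR _ tame1).
under eq_Rintegral do rewrite mul1r.
by rewrite gt_eqF// partition_function_gt0.
Qed.

(* Comparison of means at different parameters *)
#[local] Opaque partition_function.

Lemma mean_affine theta c k :
  mean theta (fun x => c + k * x%:~R) = c + k * mean theta (fun x => x%:~R).
Proof.
transitivity (\int[M]_x (c * (1 * p theta x) + k * (x%:~R * p theta x))).
  by apply: eq_Rintegral => x _; move: (p theta x) => u; ring.
rewrite Rintegral_gibbsD; last 2 first.
- exact/tameZ/tame_density/tame1.
- exact/tameZ/tame_density/tame_intr.
rewrite (Rintegral_gibbsZ c _ (tame_density theta _ tame1)).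
rewrite (Rintegral_gibbsZ k _ (tame_density theta _ tame_intr)).
by rewrite -/(mean theta (fun=> 1)) mean1 mulr1.
Qed.

(** Density with respect to [M] of the signed measure [a * mu theta1 + b * mu theta2 - mu theta]. *)
Definition density_gap a b theta1 theta theta2 x : R :=
  a * p theta1 x + b * p theta2 x - p theta x.

Lemma tame_density_gap a b theta1 theta theta2 g : tame g ->
  tame (fun x => g x * density_gap a b theta1 theta theta2 x).
Proof.
move=> tg; pose t c th : tame (fun x => c * (g x * p th x)) := tameZ c _ (tame_density th _ tg).
by apply: tame_ext (tameD _ _ (tameD _ _ (t a theta1) (t b theta2)) (t (- 1) theta)) => x;
  rewrite /density_gap; move: (p theta1 x) (p theta2 x) (p theta x) => u v w; ring.
Qed.

Lemma Rintegral_density_gap a b theta1 theta theta2 g : tame g ->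
  \int[M]_x (g x * density_gap a b theta1 theta theta2 x) =
  a * mean theta1 g + b * mean theta2 g - mean theta g.
Proof.
move=> tg; have t c th : tame (fun x => c * (g x * p th x)) by exact/tameZ/tame_density.
have E c th : \int[M]_x (c * (g x * p th x)) = c * mean th g.
  exact: (Rintegral_gibbsZ c _ (tame_density th _ tg)).
transitivity (\int[M]_x (a * (g x * p theta1 x) + b * (g x * p theta2 x) +
  (- 1) * (g x * p theta x))).
  apply: eq_Rintegral => x _; rewrite /density_gap.
  move: (p theta1 x) (p theta2 x) (p theta x) => u v w; ring.
rewrite Rintegral_gibbsD; [|exact: tameD|exact: t].
rewrite Rintegral_gibbsD; [|exact: t|exact: t].
by congr (_ + _ + _); [exact: E|exact: E|rewrite E mulN1r].
Qed.

#[local] Opaque mean.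

(** A change of parameter is an exponential tilt, whence the convex factor [s] in [density_gap]. *)
Lemma gibbs_density_ratio theta theta' x :
  p theta' x = p theta x *
    (partition_function theta / partition_function theta' * expR ((theta' - theta) * x%:~R)).
Proof.
have := gt_eqF (partition_function_gt0 theta); have := gt_eqF (partition_function_gt0 theta').
have := gt_eqF (expR_gt0 (theta * x%:~R)).
rewrite /gibbs_density mulrBl expRD expRN.
move: (partition_function theta) (partition_function theta') => z z'.
move: (expR _) (expR _) => e e' e0 z'0 z0.
by field; rewrite e0 z'0 z0.
Qed.

(** The equality case is kept apart, since strictness will be drawn from only one of the two terms
    of the flux. *)
Lemma mean_le_convex phi a b theta1 theta theta2 :
  tame phi -> convex_on_int phi -> theta1 < theta -> theta < theta2 ->
  0 < a -> 0 < b -> a + b = 1 ->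
  mean theta (fun x => x%:~R) =
    a * mean theta1 (fun x => x%:~R) + b * mean theta2 (fun x => x%:~R) ->
  mean theta phi <= a * mean theta1 phi + b * mean theta2 phi /\
  (mean theta phi = a * mean theta1 phi + b * mean theta2 phi ->
    exists c k (B : nat), forall x, (B < `|x|)%N -> phi x = c + k * x%:~R).
Proof.
move=> tphi phic t1t tt2 a0 b0 ab1 meanE.
pose r := density_gap a b theta1 theta theta2.
pose al := a * (partition_function theta / partition_function theta1).
pose be := b * (partition_function theta / partition_function theta2).
have al0 : 0 < al by rewrite mulr_gt0 ?divr_gt0 ?partition_function_gt0.
have be0 : 0 < be by rewrite mulr_gt0 ?divr_gt0 ?partition_function_gt0.
pose s x := al * expR ((theta1 - theta) * x%:~R) + be * expR ((theta2 - theta) * x%:~R) - 1.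
have rE x : r x = p theta x * s x.
  rewrite /r /density_gap (gibbs_density_ratio theta theta1) (gibbs_density_ratio theta theta2).
  rewrite /s /al /be; move: (p theta x) (expR _) (expR _) => u e e'.
  move: (_ / partition_function theta1) (_ / partition_function theta2) => z z'; ring.
clearbody al be.
have sc : convex_on_int s by apply: convex_on_int_expR2; exact: ltW.
have [B sB] : exists B : nat, forall x, (B < `|x|)%N -> 0 < s x.
  by apply: expR2_gt1; rewrite ?subr_lt0 ?subr_gt0.
have ir g : tame g -> \int[M]_x (g x * r x) =
    a * mean theta1 g + b * mean theta2 g - mean theta g.
  by move=> tg; rewrite /r Rintegral_density_gap.
have tr g : tame g -> tame (fun x => g x * r x) by move=> tg; apply: tame_density_gap.
(* Otherwise [r] would be positive everywhere, although its integral is [a + b - 1 = 0]. *)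
have s0 : exists x, s x <= 0.
  apply: contrapT => ns.
  have s_gt0 x : 0 < s x by rewrite ltNge; apply/negP => sx; apply: ns; exists x.
  have r_gt0 x : 0 < 1 * r x by rewrite mul1r rE mulr_gt0 ?gibbs_density_gt0.
  have := Rintegral_gibbs_eq0 _ (tr _ tame1) (fun x => ltW (r_gt0 x)).
  rewrite ir; last exact: tame1.
  by rewrite !mean1 !mulr1 ab1 subrr => /(_ erefl 0)/eqP; rewrite gt_eqF.
have [c [k ckP]] := convex_on_int_crossing phi s B phic sc sB s0.
pose g x := phi x - (c + k * x%:~R).
have taff : tame (fun x => c + k * x%:~R).
  apply: tameD; last exact/tameZ/tame_intr.
  by apply: tame_ext (tameZ c _ tame1) => x; rewrite mulr1.
have tg : tame g.
  by apply: tame_ext (tameD _ _ tphi (tameZ (-1) _ taff)) => x; rewrite mulN1r.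
have gr0 x : 0 <= g x * r x.
  by rewrite rE mulrCA; apply: mulr_ge0; [exact/ltW/gibbs_density_gt0|exact: ckP].
(* Subtracting the line changes nothing: [r] annihilates constants by [a + b = 1] and the identity
   by [meanE]. *)
have igr : \int[M]_x (g x * r x) =
    a * mean theta1 phi + b * mean theta2 phi - mean theta phi.
  rewrite -ir//.
  transitivity (\int[M]_x (phi x * r x + (-1) * ((c + k * x%:~R) * r x))).
    by apply: eq_Rintegral => x _; rewrite /g; move: (r x) => u; ring.
  rewrite Rintegral_gibbsD; [|exact: tr|exact/tameZ/tr].
  rewrite Rintegral_gibbsZ; last exact: tr.
  rewrite (ir _ taff) !mean_affine meanE.
  have -> : b = 1 - a by rewrite -ab1; ring.
  move: (Rintegral _ _ _) (mean theta1 _) (mean theta2 _) => u v w; ring.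
split=> [|E].
  by rewrite -subr_ge0 -igr; apply: Rintegral_ge0.
(* In case of equality [g * r] vanishes everywhere, hence so does [g] beyond [B], where [r] is
   positive. *)
have g0 := Rintegral_gibbs_eq0 _ (tr _ tg) gr0.
exists c, k, B => x Bx; apply/eqP; rewrite -subr_eq0 -/(g x).
have := g0; rewrite igr E subrr => /(_ erefl x)/eqP.
rewrite mulf_eq0 => /orP[//|].
by rewrite rE gt_eqF// mulr_gt0 ?gibbs_density_gt0// sB.
Qed.

(** The difference of the two densities has the sign of [x - x0]; the constant [x0] does not
    contribute, both total masses being [1]. *)
Lemma mean_id_lt theta1 theta2 : theta1 < theta2 ->
  mean theta1 (fun x => x%:~R) < mean theta2 (fun x => x%:~R).
Proof.
move=> t12; pose r := density_gap 0 1 theta1 theta1 theta2.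
pose d := theta2 - theta1.
have d0 : 0 < d by rewrite subr_gt0.
(* The real point at which the exponential ratio of the two densities equals [1]. *)
pose x0 := ln (partition_function theta2 / partition_function theta1) / d.
have Z1 := partition_function_gt0 theta1.
have Z2 := partition_function_gt0 theta2.
have rE x : r x = p theta1 x * (expR (d * (x%:~R - x0)) - 1).
  rewrite /r /density_gap (gibbs_density_ratio theta1 theta2) mul0r add0r mul1r.
  rewrite [d * (_ - x0)]mulrBr [d * x0]mulrC divfK ?gt_eqF// expRD expRN lnK ?posrE ?divr_gt0//.
  by rewrite invf_div mulrBr mulr1 [expR _ * _]mulrC.
have tg : tame (fun x => x%:~R - x0).
  by apply: tame_ext (tameD _ _ tame_intr (tameZ (- x0) _ tame1)) => x; rewrite mulr1.
have gr0 x : 0 <= (x%:~R - x0) * r x.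
  rewrite rE mulrCA mulr_ge0//; first by rewrite ltW// gibbs_density_gt0.
  have [xx0|xx0] := leP 0 (x%:~R - x0).
    by rewrite mulr_ge0// subr_ge0 -[leLHS]expR0 ler_expR mulr_ge0// ltW.
  rewrite mulr_le0 ?(ltW xx0)// subr_le0 -[leRHS]expR0 ler_expR mulr_ge0_le0// ltW//.
have igr : \int[M]_x ((x%:~R - x0) * r x) =
    mean theta2 (fun x => x%:~R) - mean theta1 (fun x => x%:~R).
  rewrite Rintegral_density_gap// mul0r add0r mul1r.
  have E theta : mean theta (fun x => x%:~R - x0) = mean theta (fun x => x%:~R) - x0.
    rewrite -[in RHS](mul1r (mean theta _)) addrC -mean_affine.
    by congr mean; apply/funext => x; ring.
  by rewrite !E opprB addrA subrK.
rewrite -subr_gt0 -igr lt_neqAle Rintegral_ge0// andbT eq_sym.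
apply/negP => /eqP i0.
(* At an integer beyond [x0] the integrand is positive, so its integral cannot vanish. *)
pose n : int := (Num.truncn `|x0|).+1.
have xx0 : 0 < n%:~R - x0.
  by rewrite subr_gt0 (le_lt_trans (ler_norm _))// truncnS_gt.
have : 0 < (n%:~R - x0) * r n.
  rewrite rE; apply: mulr_gt0 => //; apply: mulr_gt0; first exact: gibbs_density_gt0.
  by rewrite subr_gt0 -[ltLHS]expR0 ltr_expR mulr_gt0.
by rewrite (Rintegral_gibbs_eq0 _ (tame_density_gap _ _ _ _ _ _ tg) gr0 i0 n) ltxx.
Qed.

(** * Convexity and non-affinity of the rates *)

Lemma convex_rateN : convex_on_int (fun x => (f (- x))%:num).
Proof.
move=> x y xy; rewrite -subr_ge0 in xy.
have := f_convex (- (y + 1)) (- (x + 1)); rewrite -subr_ge0.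
rewrite (_ : - (x + 1) - - (y + 1) = y - x); last by ring.
rewrite (_ : - (y + 1) + 1 = - y); last by ring.
rewrite (_ : - (x + 1) + 1 = - x); last by ring.
by move=> /(_ xy); lra.
Qed.

(** Monotonicity gives [k >= 0]; [k > 0] would make [f] negative far to the left; [k = 0] gives the
    same value near both ends, so that the monotone [f] would be constant. *)
Lemma rate_not_affine : ~ exists c k (B : nat), forall x, (B < `|x|)%N ->
  (f x)%:num = c + k * x%:~R.
Proof.
move=> [c [k [B fE]]].
have k0 : 0 <= k.
  have := f_nondecreasing B.+1%:Z B.+2%:Z; rewrite lez_nat leqnSn => /(_ isT).
  rewrite !fE//; have -> : B.+2%:~R = B.+1%:~R + 1 :> R by rewrite intS addrC rmorphD.
  by rewrite mulrDr; lra.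
have {}k0 : k = 0.
  apply/eqP; rewrite eq_le k0 andbT leNgt; apply/negP => k_gt0.
  pose n := (B + (Num.truncn (c / k)).+1)%N.
  have : 0 < (f (- n%:Z))%:num by [].
  have ckn : c / k < n%:R.
    by rewrite (lt_le_trans (truncnS_gt _))// ler_nat leq_addl.
  rewrite fE; last by rewrite abszN /= /n -addSnnS leq_addr.
  rewrite rmorphN/= mulrN subr_gt0 -ltr_pdivlMl// mulrC.
  by move=> /lt_trans /(_ ckn); rewrite ltxx.
have fc x : (B < `|x|)%N -> (f x)%:num = c by move=> /fE ->; rewrite k0 mul0r addr0.
apply: (rate_cst B.+1%:Z) => x; rewrite (fc B.+1%:Z)//.
pose n := (B + `|x|).+1; apply/le_anti/andP; split.
  by rewrite -(fc n%:Z); [apply: f_nondecreasing|]; rewrite /n; lia.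
by rewrite -(fc (- n%:Z)); [apply: f_nondecreasing|]; rewrite /n; lia.
Qed.

(** * Inversion of the density and strict convexity of the flux *)

Lemma density_lt theta1 theta2 : theta1 < theta2 -> density f theta1 < density f theta2.
Proof. by move=> t12; rewrite !density_mean; exact: mean_id_lt. Qed.

Lemma density_inj : injective (density f).
Proof.
by move=> t1 t2 e; case: (ltgtP t1 t2) => // /density_lt; rewrite e ltxx.
Qed.

Lemma theta_ofK theta : theta_range f theta -> theta_of f (density f theta) = theta.
Proof.
move=> t; apply: pinvKV; last by rewrite inE.
by move=> ? ? _ _; exact: density_inj.
Qed.

(** Intermediate value theorem; the parameter found stays in [theta_range], which is an interval. *)
Lemma density_between theta1 theta2 v : theta_range f theta1 -> theta_range f theta2 ->
  density f theta1 <= v <= density f theta2 ->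
  exists theta, [/\ theta_range f theta, theta1 <= theta <= theta2 & density f theta = v].
Proof.
move=> /andP[lt1 _] /andP[_ gt2] /andP[v1 v2].
have t12 : theta1 <= theta2.
  by rewrite leNgt; apply/negP => /density_lt; rewrite ltNge (le_trans v1 v2).
have [||theta] := @IVT _ (density f) theta1 theta2 v t12.
- exact/continuous_subspaceT/continuous_density.
- by rewrite ge_min v1 le_max v2 orbT.
rewrite in_itv/= => /andP[t1 t2] tv; exists theta; split=> //; last by rewrite t1 t2.
by rewrite /theta_range/= (lt_le_trans lt1) ?lee_fin// (le_lt_trans _ gt2) ?lee_fin.
Qed.

(** [mean_le_convex] applies to both [f] and [f (- _)]; the strictness comes from [f], which is not
    affine near infinity. *)
Lemma flux_conv_lt theta1 theta2 a b : theta_range f theta1 -> theta_range f theta2 ->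
  theta1 < theta2 -> 0 < a -> 0 < b -> a + b = 1 ->
  flux f (a * density f theta1 + b * density f theta2) <
    a * flux f (density f theta1) + b * flux f (density f theta2).
Proof.
move=> r1 r2 t12 a0 b0 ab1.
have d12 := density_lt _ _ t12.
have bE : b = 1 - a by rewrite -ab1; ring.
set v := a * _ + b * _.
have v1 : density f theta1 < v.
  rewrite /v bE -subr_gt0.
  rewrite (_ : _ - _ = b * (density f theta2 - density f theta1)).
    by rewrite mulr_gt0// subr_gt0.
  by rewrite bE; ring.
have v2 : v < density f theta2.
  rewrite /v bE -subr_gt0.
  rewrite (_ : _ - _ = a * (density f theta2 - density f theta1)).
    by rewrite mulr_gt0// subr_gt0.
  by ring.
have [|theta [r _ tv]] := density_between theta1 theta2 v r1 r2; first by rewrite !ltW.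
have t1 : theta1 < theta.
  rewrite ltNge le_eqVlt; apply/negP => /predU1P[e|/density_lt]; last first.
    by rewrite tv ltNge (ltW v1).
  by move: v1; rewrite -tv e ltxx.
have t2 : theta < theta2.
  rewrite ltNge le_eqVlt; apply/negP => /predU1P[e|/density_lt]; last first.
    by rewrite tv ltNge (ltW v2).
  by move: v2; rewrite -tv e ltxx.
rewrite -tv !flux_mean !theta_ofK//.
have mE : mean theta (fun x => x%:~R) =
    a * mean theta1 (fun x => x%:~R) + b * mean theta2 (fun x => x%:~R).
  by rewrite -!density_mean tv.
have [le1 eq1] := mean_le_convex _ _ _ _ _ _ tame_rate f_convex t1 t2 a0 b0 ab1 mE.
have [le2 _] := mean_le_convex _ _ _ _ _ _ tame_rateN convex_rateN t1 t2 a0 b0 ab1 mE.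
have lt1 : mean theta (fun x => (f x)%:num) <
    a * mean theta1 (fun x => (f x)%:num) + b * mean theta2 (fun x => (f x)%:num).
  by rewrite lt_neqAle le1 andbT; apply/negP => /eqP /eq1; exact: rate_not_affine.
rewrite !mulrDr addrACA; exact: ltr_leD.
Qed.

Lemma flux_strictly_convex :
  strictly_convex_function (density_range f : set (convex_lmodType R^o)) (flux f).
Proof.
split.
- move=> x y t; rewrite !inE => -[t1 r1 <-] [t2 r2 <-].
  (* In [R^o] the abstract convex combination is the usual weighted sum. *)
  change (density_range f (t%:num * density f t1 + (1 - t%:num) * density f t2)).
  have ord th1 th2 v : theta_range f th1 -> theta_range f th2 ->
      density f th1 <= v <= density f th2 -> density_range f v.
    by move=> u1 u2 uv; have [th [r _ <-]] := density_between _ _ _ u1 u2 uv; exists th.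
  have itv (a u w : R) : 0 <= a -> a <= 1 -> u <= w -> u <= a * u + (1 - a) * w <= w.
    move=> a0 a1 uw; have : 0 <= a * (w - u) by rewrite mulr_ge0// subr_ge0.
    have : 0 <= (1 - a) * (w - u) by rewrite mulr_ge0// subr_ge0.
    by move=> *; apply/andP; split; lra.
  have [d12|d21] := leP (density f t1) (density f t2).
    by apply: (ord t1 t2) => //; apply: itv.
  (* In the reversed order, [1 - t] plays the role of [t]. *)
  apply: (ord t2 t1) => //; rewrite addrC -[in X in _ + X](subKr 1 t%:num).
  by apply: itv; [rewrite subr_ge0|rewrite gerBl|exact: ltW].
- move=> t /andP[t0 t1] x y; rewrite !inE => -[th1 r1 <-] [th2 r2 <-] xy.
  change (flux f (t%:num * density f th1 + (1 - t%:num) * density f th2) <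
    t%:num * flux f (density f th1) + (1 - t%:num) * flux f (density f th2)).
  have t'0 : 0 < (1 - t%:num) by rewrite subr_gt0.
  have tt : t%:num + (1 - t%:num) = 1 by rewrite addrC subrK.
  case: (ltgtP th1 th2) => [t12|t21|e]; last by rewrite e eqxx in xy.
    exact: flux_conv_lt.
  rewrite addrC [ltRHS]addrC; apply: flux_conv_lt => //.
  by rewrite addrC.
Qed.

End bricklayer_weights.

Theorem proposition3p2 (R : realType) (f : int -> {posnum R})
  (f_nondecreasing : forall x y : int, x <= y -> (f x)%:num <= (f y)%:num)
  (f_symm : forall x : int, (f x)%:num * (f (1 - x))%:num = 1)
  (theta_range0 : (theta_inf f < 0 < theta_sup f)%E)
  (f_convex : forall x y : int, x <= y ->
    (f (x + 1))%:num - (f x)%:num <= (f (y + 1))%:num - (f y)%:num)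
  (f_neq1 : ~ (forall x : int, (f x)%:num = 1)) :
  strictly_convex_function (density_range f : set (convex_lmodType R^o)) (flux f).
Proof. exact: flux_strictly_convex. Qed.
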